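(* For all integers $n\ge0$, the sequences $(w(m,n))_{m\in\mathbb{Z}}$ and $(z(m,n))_{m\in\mathbb{Z}}$ are both symmetric and unimodal. In particular, for all integers $m,n\ge0$: $w(m,n)>w(m+2,n)$ provided $w(m,n)\ne0$, and $z(m,n)>z(m+2,n)$ provided $z(m,n)\ne0$.
   Context: $(a;q)_n=\prod_{0\le j<n}(1-aq^j)$, $(a,b;q)_n=(a;q)_n(b;q)_n$; in particular $(q;-q)_{2n+1}=\prod_{0\le j\le 2n}(1-q(-q)^j)$. Define $w(m,n)$ and $z(m,n)$ by $$\sum_{n\ge0}\sum_{m\in\mathbb{Z}}w(m,n)x^mq^n=\sum_{n\ge0}\frac{(-xq,-x^{-1}q;q^2)_nq^{2n}}{(q;-q)_{2n+1}},\qquad \sum_{n\ge0}\sum_{m\in\mathbb{Z}}z(m,n)x^mq^n=\sum_{n\ge0}\frac{(-xq,-x^{-1}q;q)_nq^n}{(q;q)_{2n+1}}.$$ A two-sided sequence with finitely many nonzero terms is symmetric if its $m$-th and $(-m)$-th terms agree, and unimodal if, restricted to the smallest interval of indices containing all its nonzero terms, it first weakly increases and then weakly decreases. *)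

(* Defs.v *)
From HB Require Import structures.
From mathcomp Require Import all_boot all_order all_algebra.
From mathcomp Require Import finmap boolp monalg.

Set Implicit Arguments.
Unset Strict Implicit.
Unset Printing Implicit Defensive.

Import Order.TTheory GRing.Theory Num.Theory.
Local Open Scope fset_scope.
Local Open Scope ring_scope.

(* The ring Z[x, x^-1]: finitely supported functions int -> int under
   convolution. The ring structure of monalg is not available here, because it
   requires an exponent monoid without nontrivial units. *)
Definition laurent : Type := {malg int[int]}.

HB.instance Definition _ := GRing.Zmodule.on laurent.

Definition xpow (m : int) : laurent := mkmalgU m 1.

Definition laurent_mul (f g : laurent) : laurent :=
  \sum_(i <- msupp f) \sum_(j <- msupp g)
     mkmalgU (i + j)%R (mcoeff i f * mcoeff j g).

Section LaurentRing.
Implicit Types f g h : laurent.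

Lemma laurent_mulw (d1 d2 : {fset int}) f g :
  msupp f `<=` d1 -> msupp g `<=` d2 ->
  laurent_mul f g = \sum_(i <- d1) \sum_(j <- d2)
    mkmalgU (i + j)%R (mcoeff i f * mcoeff j g).
Proof.
move=> le_d1 le_d2; rewrite /laurent_mul (big_fset_incl _ le_d1) /=.
  apply/eq_bigr=> k1 _; apply/big_fset_incl => // k _ /mcoeff_outdom ->.
  by rewrite mulr0 monalgU0.
move=> k _ /mcoeff_outdom g1k.
by rewrite big1 => // k' _; rewrite g1k mul0r monalgU0.
Qed.

Lemma laurent_mulC : commutative laurent_mul.
Proof.
move=> f g; rewrite /laurent_mul exchange_big /=.
by apply/eq_bigr=> i _; apply/eq_bigr=> j _; rewrite addrC mulrC.
Qed.

Lemma laurent_mul0 : left_zero 0 laurent_mul.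
Proof. by move=> g; rewrite /laurent_mul msupp0 big_seq_fset0. Qed.

Lemma laurent_mulU c d (i j : int) :
  laurent_mul (mkmalgU i c) (mkmalgU j d) = mkmalgU (i + j)%R (c * d).
Proof.
rewrite (laurent_mulw (d1 := [fset i]) (d2 := [fset j])) ?msuppU_le //.
by rewrite !big_seq_fset1 !mcoeffUU.
Qed.

Lemma laurent_mulDl : left_distributive laurent_mul +%R.
Proof.
move=> f g h.
rewrite (laurent_mulw (msuppD_le _ _) (fsubset_refl _)).
rewrite (laurent_mulw (fsubsetUl _ (msupp g)) (fsubset_refl (msupp h))).
rewrite (laurent_mulw (fsubsetUr (msupp f) _) (fsubset_refl (msupp h))).
rewrite -big_split /=; apply/eq_bigr=> k1 _.
rewrite -big_split /=; apply/eq_bigr=> k2 _.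
by rewrite mcoeffD mulrDl monalgUD.
Qed.

Lemma laurent_mulDr : right_distributive laurent_mul +%R.
Proof. by move=> f g h; rewrite laurent_mulC laurent_mulDl !(laurent_mulC f). Qed.

Lemma laurent_mulr0 : right_zero 0 laurent_mul.
Proof. by move=> g; rewrite laurent_mulC laurent_mul0. Qed.

Lemma laurent_suml (I : Type) (r : seq I) (F : I -> laurent) g :
  laurent_mul (\sum_(i <- r) F i) g = \sum_(i <- r) laurent_mul (F i) g.
Proof.
exact: (big_morph (laurent_mul^~ g) (fun _ _ => laurent_mulDl _ _ _)
  (laurent_mul0 _)).
Qed.

Lemma laurent_sumr (I : Type) (r : seq I) (F : I -> laurent) g :
  laurent_mul g (\sum_(i <- r) F i) = \sum_(i <- r) laurent_mul g (F i).
Proof.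
exact: (big_morph (laurent_mul g) (fun _ _ => laurent_mulDr _ _ _)
  (laurent_mulr0 _)).
Qed.

Lemma laurent_mulA : associative laurent_mul.
Proof.
move=> f g h; have mulE := laurent_mulU.
move: laurent_suml laurent_sumr mulE; move: laurent_mul => mul sumDl sumDr mulE.
rewrite [f]monalgE !sumDl; apply/eq_bigr=> i _.
rewrite [g]monalgE !(sumDl, sumDr); apply/eq_bigr=> j _.
rewrite [h]monalgE !sumDr; apply/eq_bigr=> k _.
by rewrite !mulE mulrA addrA.
Qed.

Lemma laurent_mul1 : left_id (xpow 0) laurent_mul.
Proof.
move=> f; rewrite [f]monalgE laurent_sumr.
by apply/eq_bigr=> i _; rewrite laurent_mulU mul1r add0r.
Qed.

Lemma laurent_oner_neq0 : xpow 0 != 0.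
Proof. by apply/eqP/malgP=> /(_ 0) /eqP; rewrite mcoeffUU mcoeff0. Qed.

End LaurentRing.

HB.instance Definition _ := GRing.Zmodule_isComNzRing.Build laurent
  laurent_mulA laurent_mulC laurent_mul1 laurent_mulDl laurent_oner_neq0.

Lemma xpowD (i j : int) : xpow (i + j) = xpow i * xpow j.
Proof. by rewrite /GRing.mul /= laurent_mulU mulr1. Qed.

Record fps (R : Type) := Fps { fps_coef : nat -> R }.
Coercion fps_coef : fps >-> Funclass.

HB.instance Definition _ (R : Type) := gen_eqMixin (fps R).
HB.instance Definition _ (R : Type) := gen_choiceMixin (fps R).

Lemma fpsP (R : Type) (f g : fps R) : f =1 g <-> f = g.
Proof. by split=> [|-> //]; case: f g => [f] [g] /funext /= ->. Qed.

Section FpsRing.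
Variable R : comNzRingType.
Implicit Types f g h : fps R.

Definition fps_zero : fps R := Fps (fun=> 0).
Definition fps_one : fps R := Fps (fun n => (n == 0%N)%:R).
Definition fps_opp f : fps R := Fps (fun n => - f n).
Definition fps_add f g : fps R := Fps (fun n => f n + g n).
Definition fps_mul f g : fps R := Fps (fun n => \sum_(i < n.+1) f i * g (n - i)%N).

Fact fps_addA : associative fps_add.
Proof. by move=> f g h; apply/fpsP=> n /=; rewrite addrA. Qed.
Fact fps_addC : commutative fps_add.
Proof. by move=> f g; apply/fpsP=> n /=; rewrite addrC. Qed.
Fact fps_add0 : left_id fps_zero fps_add.
Proof. by move=> f; apply/fpsP=> n /=; rewrite add0r. Qed.
Fact fps_addN : left_inverse fps_zero fps_opp fps_add.
Proof. by move=> f; apply/fpsP=> n /=; rewrite addNr. Qed.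

HB.instance Definition _ := GRing.isZmodule.Build (fps R)
  fps_addA fps_addC fps_add0 fps_addN.

Definition fps_trunc n f : {poly R} := \poly_(i < n.+1) f i.

Lemma fps_mul_trunc n k f g :
  (k <= n)%N -> fps_mul f g k = (fps_trunc n f * fps_trunc n g)`_k.
Proof.
move=> le_kn; rewrite coefM /=; apply/eq_bigr=> -[i /= lt_ik] _.
rewrite !coef_poly !ltnS (leq_trans _ le_kn) 1?(leq_trans _ le_kn) ?leq_subr //.
Qed.

Fact fps_mulC : commutative fps_mul.
Proof.
by move=> f g; apply/fpsP=> n; rewrite !(fps_mul_trunc _ _ (leqnn n)) mulrC.
Qed.

Lemma fps_mulA_trunc n f g h :
  fps_mul (fps_mul f g) h n = (fps_trunc n f * fps_trunc n g * fps_trunc n h)`_n.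
Proof.
rewrite (fps_mul_trunc _ _ (leqnn n)) !coefM; apply/eq_bigr=> -[i /= lt_in] _.
by rewrite {1}coef_poly lt_in (fps_mul_trunc (n := n)).
Qed.

Fact fps_mulA : associative fps_mul.
Proof.
move=> f g h; apply/fpsP=> n.
rewrite fps_mulC !fps_mulA_trunc; congr (_`_n).
by rewrite mulrC mulrA.
Qed.

Fact fps_mul1 : left_id fps_one fps_mul.
Proof.
move=> f; apply/fpsP=> n /=; rewrite big_ord_recl /= mul1r subn0.
by rewrite big1 ?addr0 // => i _; rewrite mul0r.
Qed.

Fact fps_mulDl : left_distributive fps_mul fps_add.
Proof.
move=> f g h; apply/fpsP=> n /=; rewrite -big_split /=.
by apply/eq_bigr=> i _; rewrite mulrDl.
Qed.

Fact fps_oner_neq0 : fps_one != 0 :> fps R.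
Proof. by apply/eqP=> /fpsP/(_ 0%N)/eqP; rewrite /= oner_eq0. Qed.

HB.instance Definition _ := GRing.Zmodule_isComNzRing.Build (fps R)
  fps_mulA fps_mulC fps_mul1 fps_mulDl fps_oner_neq0.

End FpsRing.

Section FpsTheory.
Variable R : comNzRingType.
Implicit Types f g h : fps R.

Definition fpsC (c : R) : fps R := Fps (fun n => if n == 0%N then c else 0).

Definition fpsX : fps R := Fps (fun n => (n == 1%N)%:R).

(* The formal sum t 0 + t 1 + ..., for families in which t k is divisible by the
   k-th power of the variable; fps_sumE justifies the truncation. *)
Definition fps_sum (t : nat -> fps R) : fps R :=
  Fps (fun n => \sum_(k < n.+1) t k n).

(* The inverse of a series f with constant term 1, as the geometric series of
   1 - f; see fps_divE. *)
Definition fps_inv f : fps R := fps_sum (fun k => (1 - f) ^+ k).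

Lemma fps_coef_sum (I : Type) (r : seq I) (P : pred I) (F : I -> fps R) n :
  (\sum_(i <- r | P i) F i) n = \sum_(i <- r | P i) F i n.
Proof. by elim/big_rec2: _ => // i _ f _ <-. Qed.

Lemma fps_sumE (t : nat -> fps R) n N :
  (forall k i, (i < k)%N -> t k i = 0) -> (n < N)%N ->
  fps_sum t n = (\sum_(k < N) t k) n.
Proof.
move=> t0 lt_nN; rewrite fps_coef_sum /=.
rewrite -(big_mkord xpredT (t^~ n)) -(big_mkord xpredT (t^~ n)).
rewrite [RHS](big_cat_nat (n := n.+1)) //= [X in _ + X]big1_seq ?addr0 //.
by move=> k /andP[_]; rewrite mem_index_iota => /andP[/t0].
Qed.

Lemma fps_coef0M f g : (f * g) 0%N = f 0%N * g 0%N.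
Proof. exact: big_ord1. Qed.

Lemma fps_mul_ord f g a b :
  (forall i, (i < a)%N -> f i = 0) -> (forall i, (i < b)%N -> g i = 0) ->
  forall i, (i < a + b)%N -> (f * g) i = 0.
Proof.
move=> f0 g0 i lt_i; rewrite /GRing.mul /= big1 // => -[j /= le_ji] _.
have [/f0->|le_aj] := ltnP j a; first by rewrite mul0r.
by rewrite g0 ?mulr0 // ltn_subLR // (leq_trans lt_i) // leq_add2r.
Qed.

Lemma fps_exp_ord f k :
  f 0%N = 0 -> forall i, (i < k)%N -> (f ^+ k) i = 0.
Proof.
move=> f0; elim: k => // k IHk i; rewrite exprS => lt_ik.
by apply: (@fps_mul_ord _ _ 1 k) lt_ik => // -[].
Qed.

Lemma fps_divE f : f 0%N = 1 -> f * fps_inv f = 1.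
Proof.
move=> f0; set g := 1 - f.
have g0 : g 0%N = 0 by rewrite /g /GRing.add /GRing.opp /= f0 subrr.
have gk k i : (i < k)%N -> (g ^+ k) i = 0 by exact: fps_exp_ord.
apply/fpsP=> n.
have -> : (f * fps_inv f) n = (f * \sum_(k < n.+1) g ^+ k) n.
  rewrite /GRing.mul /=; apply/eq_bigr=> -[i /= lt_in] _; congr (_ * _).
  by apply: (@fps_sumE (fun k => g ^+ k)); rewrite // ltnS leq_subr.
have -> : f = 1 - g by rewrite /g opprB addrC subrK.
rewrite -[LHS]opprK -[X in - X]/((- ((1 - g) * _)) n) -mulNr opprB -subrX1.
rewrite -[X in - X]/((g ^+ n.+1) n - (1 : fps R) n) gk //.
by rewrite sub0r opprK.
Qed.

End FpsTheory.

Arguments fpsX {R}.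

(* (a; q)_n *)
Definition qpoch (A : comNzRingType) (a q : A) (n : nat) : A :=
  \prod_(j < n) (1 - a * q ^+ j).

(* The series variable q, and x^m as a constant series. *)
Definition qX : fps laurent := fpsX.
Definition xX (m : int) : fps laurent := fpsC (xpow m).

Definition wterm (n : nat) : fps laurent :=
  qpoch (- (xX 1 * qX)) (qX ^+ 2) n * qpoch (- (xX (-1) * qX)) (qX ^+ 2) n
  * qX ^+ (2 * n) * fps_inv (qpoch qX (- qX) (2 * n).+1).

Definition zterm (n : nat) : fps laurent :=
  qpoch (- (xX 1 * qX)) qX n * qpoch (- (xX (-1) * qX)) qX n
  * qX ^+ n * fps_inv (qpoch qX qX (2 * n).+1).

Definition w (m : int) (n : nat) : int := mcoeff m (fps_sum wterm n).
Definition z (m : int) (n : nat) : int := mcoeff m (fps_sum zterm n).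

(* The side conditions under which fps_inv and fps_sum have their intended
   meaning in wterm, zterm, w and z. *)
Lemma qpochX0 (q : fps laurent) n : qpoch qX q n 0%N = 1.
Proof.
rewrite /qpoch; elim/big_rec: _ => // j f _ f0.
rewrite fps_coef0M f0 mulr1 -[LHS]/(1 - (fpsX * q ^+ j) 0%N).
by rewrite fps_coef0M mul0r subr0.
Qed.

Lemma wtermE n : wterm n * qpoch qX (- qX) (2 * n).+1 =
  qpoch (- (xX 1 * qX)) (qX ^+ 2) n * qpoch (- (xX (-1) * qX)) (qX ^+ 2) n
  * qX ^+ (2 * n).
Proof.
by rewrite /wterm -[LHS]mulrA [X in _ * X]mulrC fps_divE ?mulr1 ?qpochX0.
Qed.

Lemma ztermE n : zterm n * qpoch qX qX (2 * n).+1 =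
  qpoch (- (xX 1 * qX)) qX n * qpoch (- (xX (-1) * qX)) qX n * qX ^+ n.
Proof.
by rewrite /zterm -[LHS]mulrA [X in _ * X]mulrC fps_divE ?mulr1 ?qpochX0.
Qed.

Lemma qX_ord (f g : fps laurent) n i : (i < n)%N -> (f * qX ^+ n * g) i = 0.
Proof.
move=> lt_in; rewrite mulrAC; apply: (@fps_mul_ord _ _ _ 0 n) lt_in => // j.
exact: fps_exp_ord.
Qed.

Lemma wterm_ord n i : (i < n)%N -> wterm n i = 0.
Proof.
by move=> lt_in; rewrite qX_ord // (leq_trans lt_in) // leq_pmull.
Qed.

Lemma zterm_ord n i : (i < n)%N -> zterm n i = 0.
Proof. exact: qX_ord. Qed.

(* Both predicates are meant for finitely supported a, as is the case of w^~ n
   and z^~ n, which are coefficient functions of elements of laurent. *)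
Definition two_sided_symmetric (a : int -> int) : Prop :=
  forall m, a (- m) = a m.

(* The smallest interval of indices containing all nonzero terms. *)
Definition in_hull (a : int -> int) (m : int) : Prop :=
  exists i j, [/\ a i != 0, a j != 0 & i <= m <= j].

Definition two_sided_unimodal (a : int -> int) : Prop :=
  exists p : int,
    (forall i j, in_hull a i -> in_hull a j -> i <= j <= p -> a i <= a j) /\
    (forall i j, in_hull a i -> in_hull a j -> p <= i <= j -> a j <= a i).

(* Main.v *)
Require Import Defs.
From mathcomp Require Import all_boot all_order all_algebra.
From mathcomp Require Import monalg ring zify.

(* Symmetric unimodal Laurent polynomials in x are closed under nonnegative
   combinations and under multiplication by s = x + 1 + 1/x. Every summand is of
   this kind in each power of q. For z, with y = q^k,
     (1 + x y)(1 + y/x)/(1 - y) = 1 + y^2/(1 - y) + (y/(1 - y)) s.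
   For w, the identity (-p;p)_M (p;p)_M = (p^2;p^2)_M at p = -q turns
   1/(q;-q)_{2n+1} into (-q;q^2)_{n+1}/(q^{2n+2};q^2)_{n+1}, and with y = q^{2k-1},
     (1 + x y)(1 + y/x)(1 + y) = 1 + y^3 + y(1 + y) s.
   For the strict inequality, the least power of q occurring with x^m is compared
   with the powers of q in which some summand drops strictly between x^m
   and x^{m+1}. *)

Set Implicit Arguments.
Unset Strict Implicit.
Unset Printing Implicit Defensive.
Import Order.TTheory GRing.Theory Num.Theory.
Local Open Scope ring_scope.

Lemma mcoeff_xpowM (m k : int) (g : laurent) :
  mcoeff m (xpow k * g) = mcoeff (m - k) g.
Proof.
rewrite [g]monalgE mulr_sumr !raddf_sum /=; apply: eq_bigr => i _.
rewrite {1}/GRing.mul /= laurent_mulU mul1r !mcoeffU.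
by rewrite eq_sym [in RHS]eq_sym subr_eq [i + k]addrC.
Qed.

(* Symmetry and unimodality with mode 0 in a single condition. *)
Definition radial (g : laurent) : Prop :=
  forall i j : int, (absz i <= absz j)%N -> mcoeff j g <= mcoeff i g.

Lemma radial_sym g m : radial g -> mcoeff (- m) g = mcoeff m g.
Proof. by move=> gr; apply/le_anti; rewrite !gr ?abszN. Qed.

Lemma radialP (g : laurent) :
  (forall m, mcoeff (- m) g = mcoeff m g) ->
  (forall m : nat, mcoeff m.+1%:Z g <= mcoeff m%:Z g) -> radial g.
Proof.
move=> gN gS i j.
have absE k : mcoeff k g = mcoeff (absz k)%:Z g.
  by case: (intP k) => [|n|n]; rewrite ?abszN ?gN.
rewrite (absE i) (absE j); elim: (absz j) => [|n IHn].
  by rewrite leqn0 => /eqP->.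
by rewrite leq_eqVlt => /orP[/eqP-> // | /IHn]; apply: le_trans.
Qed.

Lemma radial0 : radial 0.
Proof. by move=> i j _; rewrite !mcoeff0. Qed.

Lemma radial1 : radial 1.
Proof.
by move=> i j; rewrite !mcoeffU; case: i j => [[|i]|i] [[|j]|j].
Qed.

Lemma radialD f g : radial f -> radial g -> radial (f + g).
Proof. by move=> fr gr i j le_ij; rewrite !mcoeffD lerD ?fr ?gr. Qed.

Lemma radialMn g c : radial g -> radial (c%:R * g).
Proof.
by move=> gr i j le_ij; rewrite mulr_natl !mcoeffMn lerMn2r gr ?orbT.
Qed.

Lemma radial_sum (I : Type) (r : seq I) (P : pred I) (F : I -> laurent) :
  (forall i, radial (F i)) -> radial (\sum_(i <- r | P i) F i).
Proof. by move=> Fr; apply: big_ind => //; [apply: radial0 | apply: radialD]. Qed.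

Definition spread : laurent := xpow 1 + 1 + xpow (-1).

Lemma mcoeff_spread m g :
  mcoeff m (spread * g) = mcoeff (m - 1) g + mcoeff m g + mcoeff (m + 1) g.
Proof. by rewrite !mulrDl mul1r !mcoeffD !mcoeff_xpowM opprK. Qed.

Lemma mcoeff_spreadS g (m : nat) :
  mcoeff m%:Z (spread * g) - mcoeff m.+1%:Z (spread * g) =
  mcoeff (m%:Z - 1) g - mcoeff m.+2%:Z g.
Proof.
rewrite !mcoeff_spread.
have -> : m.+1%:Z - 1 = m by lia.
have -> : m.+1%:Z + 1 = m.+2 by lia.
have -> : m%:Z + 1 = m.+1 by lia.
by ring.
Qed.

Lemma radial_spread g : radial g -> radial (spread * g).
Proof.
move=> gr; apply: radialP => m.
  have [mB mD] : - m - 1 = - (m + 1) /\ - m + 1 = - (m - 1) by split; ring.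
  by rewrite !mcoeff_spread mB mD !(radial_sym _ gr); ring.
by rewrite -subr_ge0 mcoeff_spreadS subr_ge0 gr //; lia.
Qed.

Section FpsCoef.
Variable R : comNzRingType.
Implicit Types (f g : fps R) (c : R).

Lemma fps_coefD f g n : (f + g) n = f n + g n. Proof. by []. Qed.

Lemma fps_coefM f g n : (f * g) n = \sum_(i < n.+1) f i * g (n - i)%N.
Proof. by []. Qed.

Lemma fps_coefCM c f n : (fpsC c * f) n = c * f n.
Proof.
rewrite fps_coefM big_ord_recl /= subn0 big1 ?addr0 // => i _.
by rewrite mul0r.
Qed.

Lemma fps_coefXM f n : (fpsX * f) n = if n is n'.+1 then f n' else 0.
Proof.
rewrite fps_coefM big_ord_recl /= mul0r add0r.
case: n => [|n]; first by rewrite big_ord0.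
rewrite big_ord_recl /= mul1r subSS subn0 big1 ?addr0 // => i _.
by rewrite mul0r.
Qed.

Lemma fps_coefXnM k f n :
  (fpsX ^+ k * f) n = if (n < k)%N then 0 else f (n - k)%N.
Proof.
elim: k n => [|k IHk] n; first by rewrite expr0 mul1r subn0.
by rewrite exprS -mulrA fps_coefXM; case: n.
Qed.

Lemma fps_invP f g : f 0%N = 1 -> f * g = 1 -> fps_inv f = g.
Proof.
by move=> f0 fg1; rewrite -[LHS]mulr1 -fg1 mulrA [_ * f]mulrC fps_divE // mul1r.
Qed.

End FpsCoef.

Definition natser (a : fps laurent) : Prop := forall n, exists c : nat, a n = c%:R.

Lemma natser1 : natser 1.
Proof. by move=> n; exists (n == 0%N). Qed.

Lemma natserD a b : natser a -> natser b -> natser (a + b).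
Proof.
by move=> an bn n; case: (an n) (bn n) => c ac [d bd]; exists (c + d)%N; rewrite natrD -ac -bd.
Qed.

Lemma natser_sum_coef N (F : nat -> laurent) :
  (forall i, (i < N)%N -> exists c : nat, F i = c%:R) ->
  exists c : nat, \sum_(i < N) F i = c%:R.
Proof.
elim: N => [|N IHN] Fn; first by exists 0%N; rewrite big_ord0.
have [i lt_iN|c Fc] := IHN; first exact/Fn/ltnW.
have [//|d Fd] := Fn N.
by exists (c + d)%N; rewrite big_ord_recr /= Fc Fd natrD.
Qed.

Lemma natserM a b : natser a -> natser b -> natser (a * b).
Proof.
move=> an bn n; rewrite fps_coefM.
apply: (@natser_sum_coef _ (fun i => a i * b (n - i)%N)) => i _.
by case: (an i) (bn (n - i)%N) => c -> [d ->]; exists (c * d)%N; rewrite natrM.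
Qed.

Lemma natserX a k : natser a -> natser (a ^+ k).
Proof.
move=> an; elim: k => [|k IHk]; first exact: natser1.
by rewrite exprS; apply: natserM.
Qed.

Lemma natser_qX : natser qX.
Proof. by move=> n; exists (n == 1%N). Qed.

Definition geo k : fps laurent := fps_inv (1 - qX ^+ k).

Lemma natser_geo k : natser (geo k).
Proof.
move=> n; apply: (@natser_sum_coef _ (fun j => ((1 - (1 - qX ^+ k)) ^+ j) n)) => j _.
by rewrite subKr; apply/natserX/natserX/natser_qX.
Qed.

Lemma onesubXn0 k : (0 < k)%N -> (1 - qX ^+ k) 0%N = 1.
Proof.
case: k => // k _; rewrite fps_coefD -[qX ^+ _]mulr1.
by rewrite -[X in 1 + X]/(- (fpsX ^+ k.+1 * 1 : fps laurent) 0%N) fps_coefXnM /= subr0.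
Qed.

Lemma geoE k : (0 < k)%N -> (1 - qX ^+ k) * geo k = 1.
Proof. by move=> k0; rewrite fps_divE ?onesubXn0. Qed.

Lemma geo_rec k : (0 < k)%N -> geo k = 1 + qX ^+ k * geo k.
Proof. by move=> /geoE geo1; rewrite -[X in X + _]geo1 mulrBl mul1r subrK. Qed.

Definition radials (f : fps laurent) : Prop := forall n, radial (f n).

Lemma radials1 : radials 1.
Proof. by case=> [|n]; [apply: radial1 | apply: radial0]. Qed.

Lemma radialsD f g : radials f -> radials g -> radials (f + g).
Proof. by move=> fr gr n; apply: radialD. Qed.

Lemma radialsM a f : natser a -> radials f -> radials (a * f).
Proof.
move=> an fr n; rewrite fps_coefM; apply: radial_sum => i.
by case: (an i) => c ->; apply: radialMn.
Qed.

Lemma radials_spread f : radials f -> radials (fpsC spread * f).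
Proof. by move=> fr n; rewrite fps_coefCM; apply: radial_spread. Qed.

Definition drops (m n : nat) (f : fps laurent) : Prop :=
  mcoeff m.+1%:Z (f n) < mcoeff m%:Z (f n).

Lemma drops1 : drops 0 0 1.
Proof. by rewrite /drops !mcoeffU. Qed.

Lemma dropsDl m n f g : drops m n f -> radials g -> drops m n (f + g).
Proof. by move=> df gr; rewrite /drops fps_coefD !mcoeffD ltr_leD ?gr. Qed.

Lemma dropsDr m n f g : radials f -> drops m n g -> drops m n (f + g).
Proof. by rewrite addrC => fr dg; apply: dropsDl. Qed.

Lemma drops_qX m n k f : drops m n f -> drops m (k + n)%N (qX ^+ k * f).
Proof. by rewrite /drops fps_coefXnM ltnNge leq_addr addKn. Qed.

Lemma drops_spread m n f :
  radials f -> drops m n f -> drops m.+1 n (fpsC spread * f).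
Proof.
move=> fr df; rewrite /drops fps_coefCM -subr_gt0 mcoeff_spreadS subr_gt0.
have -> : m.+1%:Z - 1 = m by lia.
by apply: le_lt_trans df; apply: fr; rewrite /= ltnW.
Qed.

Lemma radials_fps_sum t : (forall N, radials (t N)) -> radials (fps_sum t).
Proof. by move=> tr n; apply: radial_sum => N; apply: tr. Qed.

Lemma drops_fps_sum m n N t :
  (forall N, radials (t N)) -> (N <= n)%N -> drops m n (t N) ->
  drops m n (fps_sum t).
Proof.
move=> tr le_Nn dN; rewrite /drops /= (bigD1 (Ordinal (le_Nn : N < n.+1)%N)) //=.
rewrite !mcoeffD ltr_leD //; apply: radial_sum => // i; exact: tr.
Qed.

Section Product.
Variables (e : nat -> nat) (a b : nat -> fps laurent).
Hypotheses (e_mono : {homo e : i j / (i <= j)%N}).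
Hypotheses (a_nat : forall k, natser (a k)) (b_nat : forall k, natser (b k)).

Definition radial_factor k : fps laurent :=
  1 + a k + qX ^+ e k * (1 + b k) * fpsC spread.

Definition radial_prod N : fps laurent := \prod_(k < N) radial_factor k.

Definition esum m : nat := (\sum_(k < m) e k)%N.

Lemma radial_prodS N :
  radial_prod N.+1 = radial_prod N +
  (a N * radial_prod N + (qX ^+ e N * (fpsC spread * radial_prod N) +
   qX ^+ e N * (b N * (fpsC spread * radial_prod N)))).
Proof.
by rewrite /radial_prod big_ord_recr /= /radial_factor; ring.
Qed.

Lemma radials_step N f : radials f ->
  [/\ radials (a N * f), radials (qX ^+ e N * (fpsC spread * f))
    & radials (qX ^+ e N * (b N * (fpsC spread * f)))].
Proof.
move=> fr; have sr := radials_spread fr; have qXn := natserX (e N) natser_qX.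
split; [exact: radialsM | exact: radialsM | apply: (radialsM qXn)].
exact: radialsM.
Qed.

Lemma radials_prod N : radials (radial_prod N).
Proof.
elim: N => [|N IHN]; first by rewrite /radial_prod big_ord0; apply: radials1.
have [ar sr bsr] := radials_step N IHN.
rewrite radial_prodS; apply: (radialsD IHN); apply: (radialsD ar).
exact: radialsD.
Qed.

Lemma drops_prod_stable m n N N' :
  (N <= N')%N -> drops m n (radial_prod N) -> drops m n (radial_prod N').
Proof.
move=> /subnK <-; elim: (N' - N)%N => [|d IHd] dN; first exact: dN.
have [ar sr bsr] := radials_step (d + N) (radials_prod (d + N)).
rewrite addSn radial_prodS; apply: (dropsDl (IHd dN)); apply: (radialsD ar).
exact: radialsD.
Qed.

Lemma drops_prodS m n N :
  drops m n (radial_prod N) -> drops m.+1 (e N + n)%N (radial_prod N.+1).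
Proof.
move=> dN; have Gr := radials_prod N; have [ar sr bsr] := radials_step N Gr.
rewrite radial_prodS; apply: (dropsDr Gr); apply: (dropsDr ar).
apply: (dropsDl _ bsr); apply: drops_qX; exact: drops_spread.
Qed.

Lemma esumS m : esum m.+1 = (esum m + e m)%N.
Proof. by rewrite /esum big_ord_recr. Qed.

Lemma drops_prod m0 d m N :
  drops m0 (esum m0 + d) (radial_prod m0) -> (m0 <= m <= N)%N ->
  drops m (esum m + d) (radial_prod N).
Proof.
move=> d0 /andP[/subnK <- le_mN]; apply: drops_prod_stable le_mN _.
elim: (m - m0)%N => // k IHk; rewrite addSn esumS addnAC [X in drops _ X]addnC.
exact: drops_prodS.
Qed.

Definition supported N (f : fps laurent) : Prop := forall (m : int) n,
  (N < absz m)%N || (n < esum (absz m))%N -> mcoeff m (f n) = 0.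

Lemma supportedD N f g : supported N f -> supported N g -> supported N (f + g).
Proof. by move=> fs gs m n out; rewrite fps_coefD mcoeffD fs ?gs ?addr0. Qed.

Lemma supportedM N c f : natser c -> supported N f -> supported N (c * f).
Proof.
move=> cn fs m n out; rewrite fps_coefM raddf_sum big1 //= => i _.
case: (cn i) => k ->; rewrite mulr_natl mcoeffMn fs ?mul0rn //.
case/orP: out => [->//|lt_n]; apply/orP; right.
exact: leq_ltn_trans (leq_subr _ _) lt_n.
Qed.

Lemma leq_esum i j : (i <= j)%N -> (esum i <= esum j)%N.
Proof.
move=> /subnK <-; elim: (j - i)%N => // d IHd.
by rewrite addSn esumS (leq_trans IHd) ?leq_addr.
Qed.

Lemma supported_spread N f :
  supported N f -> supported N.+1 (qX ^+ e N * (fpsC spread * f)).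
Proof.
move=> fs m n out; rewrite fps_coefXnM; case: ltnP => le_en; first by rewrite mcoeff0.
rewrite fps_coefCM mcoeff_spread.
suff f0 (i : int) : (absz m <= (absz i).+1)%N -> mcoeff i (f (n - e N)%N) = 0.
  by rewrite !f0 ?addr0 //; lia.
move=> le_mi; apply: fs; case: ltnP => //= le_iN.
case/orP: out => [|lt_n]; first lia.
rewrite ltn_subLR // (leq_trans lt_n) // addnC.
apply: leq_trans (leq_esum le_mi) _.
by rewrite esumS leq_add2l e_mono.
Qed.

Lemma supported_prod N : supported N (radial_prod N).
Proof.
elim: N => [|N IHN].
  move=> m n; rewrite /radial_prod big_ord0 => out.
  have m0 : m != 0.
    by apply: contraL out => /eqP->; rewrite /esum big_ord0.
  case: n out => [|n] _; last exact: mcoeff0.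
  by rewrite mcoeffU eq_sym (negPf m0).
have IHN' : supported N.+1 (radial_prod N).
  by move=> m n /orP[/ltnW|] out; apply: IHN; rewrite out ?orbT.
have -> : radial_prod N.+1 = (1 + a N) * radial_prod N +
    (1 + b N) * (qX ^+ e N * (fpsC spread * radial_prod N)).
  by rewrite radial_prodS; ring.
have nD := natserD natser1.
by apply: supportedD; apply: supportedM; auto; apply: supported_spread.
Qed.

Section Term.
Variables (N c : nat) (u : fps laurent).
Hypothesis (u_nat : natser (u - 1)).

Let uE f : f * qX ^+ c * u = qX ^+ c * f + (u - 1) * (qX ^+ c * f).
Proof. by ring. Qed.

Lemma radials_term : radials (radial_prod N * qX ^+ c * u).
Proof.
have r := radialsM (natserX c natser_qX) (radials_prod N).
by rewrite uE; apply: (radialsD r); apply: radialsM.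
Qed.

Lemma drops_term m n :
  drops m n (radial_prod N) -> drops m (c + n)%N (radial_prod N * qX ^+ c * u).
Proof.
move=> d; have r := radialsM (natserX c natser_qX) (radials_prod N).
by rewrite uE; apply: (dropsDl (drops_qX c d)); apply: radialsM.
Qed.

Lemma term_eq0 (m : int) n :
  (N < absz m)%N || (n < c + esum (absz m))%N ->
  mcoeff m ((radial_prod N * qX ^+ c * u) n) = 0.
Proof.
have -> : radial_prod N * qX ^+ c * u = qX ^+ c * ((1 + (u - 1)) * radial_prod N).
  by ring.
have sup := supportedM (natserD natser1 u_nat) (@supported_prod N).
move=> out; rewrite fps_coefXnM; case: ltnP => le_cn; first exact: mcoeff0.
by apply: sup; case/orP: out => [->|] //; rewrite ltn_subLR // orbC => ->.
Qed.

End Term.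

Section Series.
Variables (c : nat) (u t : nat -> fps laurent).
Hypotheses (c_gt0 : (0 < c)%N) (u_nat : forall N, natser (u N - 1)).
Hypothesis (tE : forall N, t N = radial_prod N * qX ^+ (c * N) * u N).

Lemma radials_series : radials (fps_sum t).
Proof. by apply: radials_fps_sum => N; rewrite tE; apply: radials_term. Qed.

Lemma drops_series m n N :
  drops m n (radial_prod N) -> drops m (c * N + n)%N (fps_sum t).
Proof.
move=> d; apply: (@drops_fps_sum _ _ N) => [M||].
- by rewrite tE; apply: radials_term.
- by rewrite (leq_trans (leq_pmull N c_gt0)) ?leq_addr.
- by rewrite tE; apply: drops_term.
Qed.

Lemma series_neq0 (m : int) n :
  mcoeff m (fps_sum t n) != 0 -> (c * absz m + esum (absz m) <= n)%N.
Proof.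
apply: contraR; rewrite -ltnNge => lt_n.
rewrite raddf_sum big1 //= => N _; rewrite tE; apply: term_eq0 => //.
case: ltnP => //= le_mN; apply: leq_trans lt_n _.
by rewrite leq_add2r leq_mul2l le_mN orbT.
Qed.

End Series.

End Product.

Lemma natser1pM f g : natser (f - 1) -> natser (g - 1) -> natser (f * g - 1).
Proof.
move=> fn gn; have -> : f * g - 1 = (f - 1) * (g - 1) + ((f - 1) + (g - 1)) by ring.
by apply: natserD; [apply: natserM | apply: natserD].
Qed.

Lemma natser1p_geo_prod N (k : nat -> nat) : (forall j, (0 < k j)%N) ->
  natser (\prod_(j < N) geo (k j) - 1).
Proof.
move=> k0; elim: N => [|N IHN].
  by rewrite big_ord0 subrr => n; exists 0%N.
rewrite big_ord_recr; apply: natser1pM IHN _.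
rewrite geo_rec // addrC addKr.
by apply: natserM; [apply/natserX/natser_qX | apply: natser_geo].
Qed.

Lemma geo_prodE N (k : nat -> nat) : (forall j, (0 < k j)%N) ->
  \prod_(j < N) (1 - qX ^+ k j) * \prod_(j < N) geo (k j) = 1.
Proof. by move=> k0; rewrite -big_split big1 // => j _; apply: geoE. Qed.

Lemma fpsC_spread : fpsC spread = xX 1 + 1 + xX (-1).
Proof. by apply/fpsP => -[|n]; rewrite !fps_coefD /= ?addr0. Qed.

Lemma xXV : xX 1 * xX (-1) = 1.
Proof. by apply/fpsP => n; rewrite fps_coefCM; case: n => [|n] /=; rewrite ?mulr0 -?xpowD. Qed.

Lemma z_factor (R : comNzRingType) (x x' y g : R) :
  x * x' = 1 -> g = 1 + y * g ->
  (1 + x * y) * (1 + x' * y) * g =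
  1 + y ^+ 2 * g + y * (1 + y * g) * (x + 1 + x').
Proof.
move=> xV gE; rewrite -gE.
have -> : (1 + x * y) * (1 + x' * y) * g =
  (1 + y ^+ 2 * (x * x') + y * (x + x')) * g by ring.
rewrite xV; transitivity (g - y * g + y ^+ 2 * g + y * g * (x + 1 + x')); first ring.
by rewrite {1}gE addrK.
Qed.

Lemma w_factor (R : comNzRingType) (x x' y : R) :
  x * x' = 1 ->
  (1 + x * y) * (1 + x' * y) * (1 + y) =
  1 + y ^+ 3 + y * (1 + y) * (x + 1 + x').
Proof.
move=> xV.
have -> : (1 + x * y) * (1 + x' * y) * (1 + y) =
  (1 + y ^+ 2 * (x * x') + y * (x + x')) * (1 + y) by ring.
by rewrite xV; ring.
Qed.

Lemma z_qpoch (R : comNzRingType) (x x' q : R) (g : nat -> R) N :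
  x * x' = 1 -> (forall k, g k = 1 + q ^+ k.+1 * g k) ->
  qpoch (- (x * q)) q N * qpoch (- (x' * q)) q N * \prod_(k < N) g k =
  \prod_(k < N) (1 + (q ^+ k.+1) ^+ 2 * g k +
                 q ^+ k.+1 * (1 + q ^+ k.+1 * g k) * (x + 1 + x')).
Proof.
move=> xV gE; rewrite /qpoch -!big_split; apply: eq_bigr => k _ /=.
by rewrite -(z_factor xV (gE k)) !mulNr !opprK -!mulrA -!exprS.
Qed.

Lemma w_qpoch (R : comNzRingType) (x x' q : R) N :
  x * x' = 1 ->
  qpoch (- (x * q)) (q ^+ 2) N * qpoch (- (x' * q)) (q ^+ 2) N *
    \prod_(k < N) (1 + q ^+ (2 * k).+1) =
  \prod_(k < N) (1 + (q ^+ (2 * k).+1) ^+ 3 +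
                 q ^+ (2 * k).+1 * (1 + q ^+ (2 * k).+1) * (x + 1 + x')).
Proof.
move=> xV; rewrite /qpoch -!big_split; apply: eq_bigr => k _ /=.
by rewrite -(w_factor _ xV) !mulNr !opprK -!mulrA -!exprM -!exprS.
Qed.

Fact mulr_interchange (R : comNzRingType) (a b c d : R) :
  a * b * (c * d) = a * c * b * d.
Proof. ring. Qed.

Definition z_prod : nat -> fps laurent :=
  radial_prod S (fun k => (qX ^+ k.+1) ^+ 2 * geo k.+1)
    (fun k => qX ^+ k.+1 * geo k.+1).

Definition z_tail N : fps laurent := \prod_(j < N.+1) geo (N + j).+1.

Lemma zterm_prod N : zterm N = z_prod N * qX ^+ (1 * N) * z_tail N.
Proof.
have invE : fps_inv (qpoch qX qX (2 * N).+1) =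
    \prod_(k < N) geo k.+1 * z_tail N.
  apply: fps_invP; first exact: qpochX0.
  have -> : (2 * N).+1 = (N + N.+1)%N by lia.
  have -> : \prod_(k < N) geo k.+1 * z_tail N = \prod_(k < N + N.+1) geo k.+1.
    by rewrite big_split_ord.
  apply: etrans (geo_prodE (N + N.+1) (k := S) (fun=> isT)); congr (_ * _).
  by apply: eq_bigr => j _; rewrite exprS.
have := z_qpoch (g := fun k => geo k.+1) N xXV (fun k => geo_rec (ltn0Sn k)).
rewrite /zterm invE mul1n /z_prod /radial_prod /radial_factor fpsC_spread.
by move=> <-; apply: mulr_interchange.
Qed.

Definition w_prod : nat -> fps laurent :=
  radial_prod (fun k => (2 * k).+1) (fun k => (qX ^+ (2 * k).+1) ^+ 3)
    (fun k => qX ^+ (2 * k).+1).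

Definition w_tail N : fps laurent :=
  (1 + qX ^+ (2 * N).+1) * \prod_(j < N.+1) geo (2 * (N + j).+1).

(* With p = -q, this is (-p;p)_M (p;p)_M = (p^2;p^2)_M for M = 2N+1. *)
Lemma qpoch_signed (R : comNzRingType) (q : R) N :
  qpoch q (- q) (2 * N).+1 *
  (\prod_(k < N.+1) (1 + q ^+ (2 * k).+1) * \prod_(k < N) (1 - q ^+ (2 * k.+1))) =
  \prod_(k < (2 * N).+1) (1 - q ^+ (2 * k.+1)).
Proof.
rewrite /qpoch; elim: N => [|N IHN].
  by rewrite !big_ord_recl !big_ord0 /= expr0 expr1; ring.
have -> : (2 * N.+1).+1 = (2 * N).+3 by lia.
rewrite 2![in RHS]big_ord_recr -IHN [in LHS]big_ord_recr [in LHS]big_ord_recr /=.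
rewrite [X in _ * (X * _) = _]big_ord_recr [X in _ * (_ * X) = _]big_ord_recr /=.
have sgn j : (- q) ^+ j = (-1) ^+ j * q ^+ j by rewrite -exprNn.
have -> : (- q) ^+ (2 * N).+1 = - q ^+ (2 * N).+1.
  by rewrite sgn -signr_odd /= oddM /= expr1 mulN1r.
have -> : (- q) ^+ (2 * N).+2 = q ^+ (2 * N).+2.
  by rewrite sgn -signr_odd /= oddM /= expr0 mul1r.
have -> : (2 * N.+1 = (2 * N).+2)%N by lia.
have -> : (2 * (2 * N).+2 = (2 * N).+2 + (2 * N).+2)%N by lia.
have -> : (2 * (2 * N).+3 = (2 * N).+3 + (2 * N).+3)%N by lia.
rewrite !exprD !exprS; ring.
Qed.

Lemma qpoch_signed_inv (R : comNzRingType) (q : R) (g : nat -> R) N :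
  (forall k, (1 - q ^+ (2 * k.+1)) * g k = 1) ->
  qpoch q (- q) (2 * N).+1 *
    (\prod_(k < N) (1 + q ^+ (2 * k).+1) *
      ((1 + q ^+ (2 * N).+1) * \prod_(k < N.+1) g (N + k)%N)) = 1.
Proof.
move=> gE; have := qpoch_signed q N; rewrite big_ord_recr /=.
have -> : (2 * N).+1 = (N + N.+1)%N by lia.
rewrite [RHS]big_split_ord /=; set B := qpoch _ _ _; set P := \prod_(k < N) _.
set u := 1 + _; set E := \prod_(k < N) _; set T := \prod_(k < N.+1) (1 - _).
set G := \prod_(k < N.+1) g _ => BPE.
have TG : T * G = 1 by rewrite -big_split big1 // => k _; apply: gE.
have EG : E * \prod_(k < N) g k = 1 by rewrite -big_split big1 // => k _; apply: gE.
rewrite -[LHS]mulr1 -EG.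
transitivity (B * (P * u * E) * G * \prod_(k < N) g k); first by ring.
by rewrite BPE -(mulrA E) TG mulr1.
Qed.

Lemma wterm_prod N : wterm N = w_prod N * qX ^+ (2 * N) * w_tail N.
Proof.
have geo2 k : (1 - qX ^+ (2 * k.+1)) * geo (2 * k.+1) = 1 by apply: geoE.
have := qpoch_signed_inv (g := fun k => geo (2 * k.+1)) N geo2.
move=> /(fps_invP (qpochX0 _ _)) invE; have := w_qpoch qX N xXV.
rewrite /wterm invE /w_prod /radial_prod /radial_factor fpsC_spread.
by move=> <-; apply: mulr_interchange.
Qed.

Lemma natser1p_z_tail N : natser (z_tail N - 1).
Proof. exact: (natser1p_geo_prod N.+1 (k := fun j => (N + j).+1)). Qed.

Lemma natser1p_w_tail N : natser (w_tail N - 1).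
Proof.
apply: natser1pM; first by rewrite addrC addKr; apply/natserX/natser_qX.
exact: (natser1p_geo_prod N.+1 (k := fun j => 2 * (N + j).+1)%N).
Qed.

Lemma natser_z_a k : natser ((qX ^+ k.+1) ^+ 2 * geo k.+1).
Proof. by apply: natserM; [apply/natserX/natserX/natser_qX | apply: natser_geo]. Qed.

Lemma natser_z_b k : natser (qX ^+ k.+1 * geo k.+1).
Proof. by apply: natserM; [apply/natserX/natser_qX | apply: natser_geo]. Qed.

Lemma natser_w_a k : natser ((qX ^+ (2 * k).+1) ^+ 3).
Proof. exact/natserX/natserX/natser_qX. Qed.

Lemma natser_w_b k : natser (qX ^+ (2 * k).+1).
Proof. exact/natserX/natser_qX. Qed.

Lemma radials_z : radials (fps_sum zterm).
Proof. exact: (radials_series natser_z_a natser_z_b natser1p_z_tail zterm_prod). Qed.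

Lemma radials_w : radials (fps_sum wterm).
Proof. exact: (radials_series natser_w_a natser_w_b natser1p_w_tail wterm_prod). Qed.

Lemma drops_z (m n : nat) :
  mcoeff m%:Z (fps_sum zterm n) != 0 -> drops m n (fps_sum zterm).
Proof.
have e_mono : {homo S : i j / (i <= j)%N} by [].
move=> /(series_neq0 e_mono natser_z_a natser_z_b natser1p_z_tail zterm_prod).
rewrite mul1n /= => le_n; set h := (n - esum S m)%N.
have -> : n = (1 * h + (esum S m + 0))%N by rewrite /h; lia.
apply: (drops_series natser_z_a natser_z_b (ltn0Sn 0) natser1p_z_tail zterm_prod).
apply: (drops_prod natser_z_a natser_z_b (m0 := 0)); last by rewrite /h; lia.
by rewrite /esum /radial_prod !big_ord0; apply: drops1.
Qed.

Lemma drops_geo1 n : drops 0 n (geo 1).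
Proof.
have gr : radials (geo 1) by rewrite -[geo 1]mulr1; apply/radialsM/radials1/natser_geo.
have qgr : radials (qX ^+ 1 * geo 1) by apply/(radialsM _ gr)/natserX/natser_qX.
elim: n => [|n IHn]; rewrite geo_rec //; first exact: (dropsDl drops1 qgr).
apply: (dropsDr radials1); exact: (drops_qX 1 IHn).
Qed.

Lemma qpoch1 (R : comNzRingType) (a q : R) : qpoch a q 1 = 1 - a.
Proof. by rewrite /qpoch big_ord1 mulr1. Qed.

Lemma wterm0 : wterm 0 = geo 1.
Proof.
have triv (R : comNzRingType) (a b q x y : R) :
  qpoch a q 0 * qpoch b q 0 * x ^+ 0 * y = y.
  by rewrite /qpoch !big_ord0 !mul1r.
apply: etrans (triv _ _ _ _ _ _) _.
exact: (congr1 (@fps_inv _) (qpoch1 _ _)).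
Qed.

Lemma drops_w_prod1 (d : bool) : drops 1 (1 + d) (w_prod 1).
Proof.
have -> : w_prod 1 = 1 + qX ^+ 3 + qX ^+ 1 * (1 + qX ^+ 1) * fpsC spread.
  exact: big_ord1.
have qXn k : natser (qX ^+ k) by exact/natserX/natser_qX.
have sr : radials (fpsC spread * 1) := radials_spread radials1.
have r3 : radials (1 + qX ^+ 3).
  by apply: (radialsD radials1); rewrite -[qX ^+ 3]mulr1; apply/(radialsM _ radials1)/qXn.
have dk k : drops 1 (k + 0) (qX ^+ k * (fpsC spread * 1)).
  exact/drops_qX/(drops_spread radials1)/drops1.
have expand (R : comNzRingType) (q s : R) :
    1 + q ^+ 3 + q ^+ 1 * (1 + q ^+ 1) * s =
    q ^+ 1 * (s * 1) + (1 + q ^+ 3) + q ^+ 2 * (s * 1) by ring.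
rewrite expand; case: d.
  by apply: dropsDr (dk 2); apply: radialsD r3; apply: radialsM.
by apply/dropsDl/(radialsM _ sr)/qXn; apply: dropsDl (dk 1) r3.
Qed.

(* The term N covers the exponents of the parity of [m * m], through the leading
   monomial of its coefficient of x^m; the other parity is reached through
   the factor [1 + q] of [q * (1 + q) * spread], and, when m = 0, through the
   term N = 0, which is [1 / (1 - q)]. *)
Lemma drops_w (m n : nat) :
  mcoeff m%:Z (fps_sum wterm n) != 0 -> drops m n (fps_sum wterm).
Proof.
pose e k := (2 * k).+1.
have e_mono : {homo e : i j / (i <= j)%N} by move=> i j; rewrite /e; lia.
move=> /(series_neq0 e_mono natser_w_a natser_w_b natser1p_w_tail wterm_prod) /= le_n.
have [->|m_gt0] := posnP m.
  apply: (@drops_fps_sum _ _ 0) => // [N|].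
    rewrite wterm_prod.
    exact: (radials_term _ natser_w_a natser_w_b _ _ (natser1p_w_tail N)).
  by rewrite wterm0; apply: drops_geo1.
have := odd_double_half (n - esum e m); set h := _./2; set d : nat := odd _ => dh.
have -> : n = (2 * h + (esum e m + d))%N.
  by rewrite -mul2n in dh; move: le_n dh; move: (esum _ _) => s; lia.
apply: (drops_series natser_w_a natser_w_b (ltn0Sn 1) natser1p_w_tail wterm_prod).
have le_mh : (m <= h)%N.
  move: dh le_n; rewrite -mul2n /d; move: (esum _ _) => s; case: (odd _) => /=; lia.
apply: (drops_prod natser_w_a natser_w_b (m0 := 1)); last by rewrite m_gt0.
by rewrite /esum big_ord1 /e /d; apply: drops_w_prod1.
Qed.

Lemma radial_two_sided (g : laurent) : radial g ->
  two_sided_symmetric (mcoeff^~ g) /\ two_sided_unimodal (mcoeff^~ g).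
Proof.
move=> gr; split=> [m|]; first exact: radial_sym.
by exists 0; split=> i j _ _ le_ij; apply: gr; lia.
Qed.

Lemma radials_drops2 (f : fps laurent) (m n : nat) : radials f ->
  (mcoeff m%:Z (f n) != 0 -> drops m n f) ->
  mcoeff m%:Z (f n) != 0 -> mcoeff (m + 2)%N%:Z (f n) < mcoeff m%:Z (f n).
Proof.
by move=> fr df /df; apply: le_lt_trans; apply: fr; rewrite addn2 /=.
Qed.

Theorem theorem4p11 :
  (forall n : nat,
     [/\ two_sided_symmetric (fun m : int => w m n),
         two_sided_unimodal (fun m : int => w m n),
         two_sided_symmetric (fun m : int => z m n)
       & two_sided_unimodal (fun m : int => z m n)]) /\
  (forall m n : nat,
     (w m%:Z n != 0 -> w (m + 2)%N%:Z n < w m%:Z n) /\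
     (z m%:Z n != 0 -> z (m + 2)%N%:Z n < z m%:Z n)).
Proof.
split=> [n|m n].
  have [ws wu] := radial_two_sided (radials_w n).
  have [zs zu] := radial_two_sided (radials_z n).
  exact: (And4 ws wu zs zu).
split; first exact: (radials_drops2 radials_w (@drops_w m n)).
exact: (radials_drops2 radials_z (@drops_z m n)).
Qed.
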